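(* Let $\mathcal{M}$ be a finite abelian category over a field $k$, let $\Sigma:\mathcal{M}\to\mathcal{M}$ be a $k$-linear right exact endofunctor, let $\mathbb{N}=\mathbb{N}_{\mathcal{M}}$ be the Nakayama functor, and let $$\mathrm{Nat}(\Sigma,\mathbb{N})\xrightarrow{\Phi_1}\mathrm{Tr}(\Sigma)\xrightarrow{\Phi_2}\mathrm{Nat}(\mathbb{h}_\Sigma,\mathbb{h}^* )\xrightarrow{\Phi_3}\mathrm{Nat}(\Sigma,\mathbb{N})$$ be the maps defined in the context. Then $\Phi_1$, $\Phi_2$ and $\Phi_3$ are bijections such that $\Phi_3\Phi_2\Phi_1$ is the identity map. Furthermore, these bijections restrict to bijections between the following three sets: - the set of non-degenerate $\Sigma$-twisted traces on $\mathrm{Proj}(\mathcal{M})$; - the set of natural isomorphisms $\Sigma\to\mathbb{N}$; - the set of natural isomorphisms $\mathbb{h}_\Sigma\to\mathbb{h}^*$.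
   Context: A finite abelian category is a $k$-linear category equivalent to the category of finite-dimensional left modules over a finite-dimensional $k$-algebra. $\mathcal{P}=\mathrm{Proj}(\mathcal{M})$ is the full subcategory of projective objects, $\mathbf{Vect}$ the category of finite-dimensional vector spaces, and $V^*$ the dual of $V$. For $V\in\mathbf{Vect}$ and $M\in\mathcal{M}$, $V\cdot M$ is defined by the natural isomorphism $\mathrm{Hom}_{\mathcal{M}}(V\cdot M,N)\cong\mathrm{Hom}_k(V,\mathrm{Hom}_{\mathcal{M}}(M,N))$; there is a canonical isomorphism $V\otimes_k\mathrm{Hom}_{\mathcal{M}}(M,M')\cong\mathrm{Hom}_{\mathcal{M}}(M,V\cdot M')$. The Nakayama functor is $\mathbb{N}(M)=\int^{X\in\mathcal{M}}\mathrm{Hom}_{\mathcal{M}}(M,X)^*\cdot X$ with universal dinatural transformation $\mathbb{i}_{X,M}$. $\mathrm{Tr}(\Sigma)$ is the set of $\Sigma$-twisted traces on $\mathcal{P}$: families of $k$-linear maps $\mathtt{t}_P:\mathrm{Hom}_{\mathcal{M}}(P,\Sigma(P))\to k$ ($P\in\mathcal{P}$) with $\mathtt{t}_P(gf)=\mathtt{t}_Q(\Sigma(f)g)$ for all $P,Q\in\mathcal{P}$, $f:P\to Q$, $g:Q\to\Sigma(P)$. Such a trace is non-degenerate if the pairing $\mathrm{Hom}_{\mathcal{M}}(M,\Sigma(P))\times\mathrm{Hom}_{\mathcal{M}}(P,M)\to k$, $(f,g)\mapsto\mathtt{t}_P(fg)$, is non-degenerate for all $M\in\mathcal{M}$, $P\in\mathcal{P}$.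 The canonical Nakayama-twisted trace $\widetilde{\mathtt{t}}_\bullet\in\mathrm{Tr}(\mathbb{N})$: $\widetilde{\mathtt{t}}_P$ is the unique linear map with $\widetilde{\mathtt{t}}_P(\mathbb{i}_{X,P}\circ\Lambda(\omega,f))=\omega(f)$ for all $X\in\mathcal{M}$, $\omega\in\mathrm{Hom}_{\mathcal{M}}(P,X)^*$, $f\in\mathrm{Hom}_{\mathcal{M}}(P,X)$, where $\Lambda(\omega,f):P\to\mathrm{Hom}_{\mathcal{M}}(P,X)^*\cdot X$ is the morphism corresponding to $\omega\otimes f$ under the canonical isomorphism. It is non-degenerate, so $\widetilde{\alpha}_{M,P}:\mathrm{Hom}_{\mathcal{M}}(M,\mathbb{N}(P))\to\mathrm{Hom}_{\mathcal{M}}(P,M)^*$, $\langle\widetilde\alpha_{M,P}(f),g\rangle=\widetilde{\mathtt{t}}_P(fg)$, is a natural isomorphism. Functors $\mathbb{h}^*,\mathbb{h}_\Sigma:\mathcal{M}^{\mathrm{op}}\times\mathcal{P}\to\mathbf{Vect}$: $\mathbb{h}^*(M,P)=\mathrm{Hom}_{\mathcal{M}}(P,M)^*$, $\mathbb{h}_\Sigma(M,P)=\mathrm{Hom}_{\mathcal{M}}(M,\Sigma(P))$. $\Phi_1(\xi)=\mathtt{t}^\xi_\bullet$ with $\mathtt{t}^\xi_P(f)=\widetilde{\mathtt{t}}_P(\xi_P\circ f)$. $\Phi_2(\mathtt{t}_\bullet)=\alpha$ with $\langle\alpha_{M,P}(f),g\rangle=\mathtt{t}_P(fg)$. $\Phi_3(\alpha)=\xi$,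 where $\xi:\Sigma\to\mathbb{N}$ is the unique natural transformation with $(\widetilde\alpha_{M,P})^{-1}\circ\alpha_{M,P}=\mathrm{Hom}_{\mathcal{M}}(M,\xi_P)$ for all $M\in\mathcal{M}$, $P\in\mathcal{P}$ (by the Yoneda lemma this determines $\xi|_{\mathcal{P}}$, and a natural transformation between $k$-linear right exact functors is determined by, and extends uniquely from, its restriction to $\mathcal{P}$). *)

(* Defs.v *)
From HB Require Import structures.
From mathcomp Require Import all_boot all_algebra.
From mathcomp Require Import boolp.
Set Implicit Arguments.
Unset Strict Implicit.
Unset Printing Implicit Defensive.
Import GRing.Theory.
Local Open Scope ring_scope.

Declare Scope cat_scope.
Delimit Scope cat_scope with cat.
Local Open Scope cat_scope.

Record category := Category {
  ob :> Type;
  mor : ob -> ob -> Type;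
  idm : forall x, mor x x;
  compm : forall x y z, mor y z -> mor x y -> mor x z;
  comp1m : forall x y (f : mor x y), compm (idm y) f = f;
  compm1 : forall x y (f : mor x y), compm f (idm x) = f;
  compA : forall x y z w (h : mor z w) (g : mor y z) (f : mor x y),
    compm h (compm g f) = compm (compm h g) f }.

Arguments idm {c} x.
Notation "g \oc f" := (compm g f)
  (at level 40, left associativity, format "g  \oc  f") : cat_scope.

Definition is_iso (C : category) (x y : C) (f : mor x y) : Prop :=
  exists g : mor y x, g \oc f = idm x /\ f \oc g = idm y.

Definition is_epi (C : category) (x y : C) (e : mor x y) : Prop :=
  forall z (f g : mor y z), f \oc e = g \oc e -> f = g.

Definition projective (C : category) (p : C) : Prop :=
  forall (x y : C) (e : mor x y) (f : mor p y),
    is_epi e -> exists g : mor p x, e \oc g = f.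

Record functor (C D : category) := Functor {
  fob :> C -> D;
  fmap : forall x y, mor x y -> mor (fob x) (fob y);
  fmap1 : forall x, fmap (idm x) = idm (fob x);
  fmapM : forall x y z (g : mor y z) (f : mor x y),
    fmap (g \oc f) = fmap g \oc fmap f }.

Arguments fmap {C D} _ {x y}.

Definition idfunctor (C : category) : functor C C :=
  @Functor C C id (fun _ _ f => f) (fun _ => erefl) (fun _ _ _ _ _ => erefl).

Definition compfunctor (C D E : category) (G : functor D E) (F : functor C D) :
  functor C E.
Proof.
exists (fun x => G (F x)) (fun x y f => fmap G (fmap F f)) => [x|x y z g f].
- by rewrite !fmap1.
- by rewrite !fmapM.
Defined.

Record nattrans (C D : category) (F G : functor C D) := NatTrans {
  ncomp :> forall x, mor (F x) (G x);
  ncompE : forall x y (f : mor x y),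
    ncomp y \oc fmap F f = fmap G f \oc ncomp x }.

Definition nat_iso (C D : category) (F G : functor C D) (eta : nattrans F G) : Prop :=
  forall x, is_iso (eta x).

Definition op_cat (C : category) : category :=
  @Category C (fun x y => mor y x) idm (fun _ _ _ g f => f \oc g)
    (fun _ _ f => compm1 f) (fun _ _ f => comp1m f)
    (fun _ _ _ _ h g f => esym (compA f g h)).

Definition prod_cat (C D : category) : category.
Proof.
apply: (@Category (C * D)%type (fun x y => mor x.1 y.1 * mor x.2 y.2)%type
  (fun x => (idm x.1, idm x.2)) (fun x y z g f => (g.1 \oc f.1, g.2 \oc f.2))).
- by move=> x y [f1 f2]; rewrite !comp1m.
- by move=> x y [f1 f2]; rewrite !compm1.
- by move=> x y z w h g f; rewrite !compA.
Defined.

Definition full_subcat (C : category) (P : C -> Prop) : category :=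
  @Category {x : C | P x} (fun x y => mor (sval x) (sval y)) (fun x => idm (sval x))
    (fun _ _ _ g f => g \oc f) (fun _ _ f => comp1m f)
    (fun _ _ f => compm1 f) (fun _ _ _ _ h g f => compA h g f).

Definition Vect (k : fieldType) : category :=
  @Category (vectType k) (fun V W => 'Hom(V, W)) (fun V => \1%VF)
    (fun _ _ _ g f => (g \o f)%VF) (fun _ _ => @comp_lfun1l _ _ _)
    (fun _ _ => @comp_lfun1r _ _ _) (fun _ _ _ _ => @comp_lfunA _ _ _ _ _).

Definition vdual (k : fieldType) (V : vectType k) : vectType k := 'Hom(V, k^o).

Section Transpose.
Variables (k : fieldType) (V W : vectType k) (a : 'Hom(V, W)).

Definition transpose_fun (w : 'Hom(W, k^o)) : 'Hom(V, k^o) := (w \o a)%VF.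

Lemma transpose_is_linear : linear transpose_fun.
Proof. by move=> c u v; rewrite /transpose_fun comp_lfunDl comp_lfunZl. Qed.
HB.instance Definition _ :=
  GRing.isLinear.Build k 'Hom(W, k^o) 'Hom(V, k^o) _ transpose_fun
    transpose_is_linear.

Definition transpose : 'Hom(vdual W, vdual V) := linfun transpose_fun.

Lemma transposeE (w : 'Hom(W, k^o)) : transpose w = (w \o a)%VF.
Proof. by rewrite lfunE. Qed.

End Transpose.

(* Finite dimensionality of the morphism spaces is part of the structure; it
   holds in every category equivalent to the finite-dimensional modules over a
   finite-dimensional algebra. *)
Record prelincat (k : fieldType) := PreLinCat {
  lin_base :> category;
  hom_vect : forall x y : lin_base, Vector.axioms_ k (mor x y) }.

HB.instance Definition _ (k : fieldType) (M : prelincat k) (x y : M) :=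
  Vector.copy (mor x y) (Vector.Pack (hom_vect x y)).

Record lincat (k : fieldType) := LinCat {
  lin_pre :> prelincat k;
  comp_linearr : forall (x y z : lin_pre) (g : mor y z),
    linear (fun f : mor x y => g \oc f);
  comp_linearl : forall (x y z : lin_pre) (f : mor x y),
    linear (fun g : mor y z => g \oc f) }.

Definition linear_functor (k : fieldType) (M M' : lincat k) (F : functor M M')
  : Prop := forall x y : M, linear (fun f : mor x y => fmap F f).

Section HomMaps.
Variables (k : fieldType) (M : lincat k).

Section Post.
Variables (x y z : M) (g : mor y z).
Definition post_fun (f : mor x y) : mor x z := g \oc f.
HB.instance Definition _ :=
  GRing.isLinear.Build k (mor x y) (mor x z) _ post_fun
    (@comp_linearr k M x y z g).
Definition postcomp : 'Hom(mor x y, mor x z) := linfun post_fun.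
Lemma postcompE f : postcomp f = g \oc f.
Proof. by rewrite lfunE. Qed.
End Post.

Section Pre.
Variables (x y z : M) (f : mor x y).
Definition pre_fun (g : mor y z) : mor x z := g \oc f.
HB.instance Definition _ :=
  GRing.isLinear.Build k (mor y z) (mor x z) _ pre_fun
    (@comp_linearl k M x y z f).
Definition precomp : 'Hom(mor y z, mor x z) := linfun pre_fun.
Lemma precompE g : precomp g = g \oc f.
Proof. by rewrite lfunE. Qed.
End Pre.

Lemma comp0m (x y z : M) (f : mor x y) : (0 : mor y z) \oc f = 0.
Proof. by rewrite -precompE linear0. Qed.

Lemma compm0 (x y z : M) (g : mor y z) : g \oc (0 : mor x y) = 0.
Proof. by rewrite -postcompE linear0. Qed.

Definition is_cokernel (x y z : M) (f : mor x y) (g : mor y z) : Prop :=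
  g \oc f = 0 /\
  forall (t : M) (h : mor y t), h \oc f = 0 ->
    exists! u : mor z t, u \oc g = h.

End HomMaps.

Arguments postcomp {k M} x {y z} g.
Arguments precomp {k M x y} z f.

(* In an abelian category x -> y -> z -> 0 is exact iff y -> z is a cokernel of
   x -> y. *)
Definition right_exact (k : fieldType) (M M' : lincat k) (F : functor M M')
  : Prop := forall (x y z : M) (f : mor x y) (g : mor y z),
    is_cokernel f g -> is_cokernel (fmap F f) (fmap F g).

(* Unlike falgType, this allows the zero algebra, hence the zero category. *)
Record fdalg (k : fieldType) := FDAlg {
  alg_car :> vectType k;
  alg_one : alg_car;
  alg_mul : 'Hom(alg_car, 'End(alg_car));
  alg_mul1l : forall a, alg_mul alg_one a = a;
  alg_mul1r : forall a, alg_mul a alg_one = a;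
  alg_mulA : forall a b c, alg_mul a (alg_mul b c) = alg_mul (alg_mul a b) c }.

Record fdmod (k : fieldType) (A : fdalg k) := FDMod {
  mod_car :> vectType k;
  modact : 'Hom(A, 'End(mod_car));
  modact1 : forall v, modact (alg_one A) v = v;
  modactM : forall a b v, modact (alg_mul A a b) v = modact a (modact b v) }.

Section Modules.
Variables (k : fieldType) (A : fdalg k).

Section ModHom.
Variables V W : fdmod A.

Definition moddefect2 (f : 'Hom(V, W)) (a : A) : 'Hom(V, W) :=
  ((f \o modact V a) - (modact W a \o f))%VF.

Lemma moddefect2_linear f : linear (moddefect2 f).
Proof.
move=> c a b; apply/lfunP => v; rewrite /moddefect2.
by rewrite !(lfun_simp, linearP) /= scalerBr scalerN addrACA.
Qed.
HB.instance Definition _ f :=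
  GRing.isLinear.Build k A 'Hom(V, W) _ (moddefect2 f) (moddefect2_linear f).

Definition moddefect (f : 'Hom(V, W)) : 'Hom(A, 'Hom(V, W)) :=
  linfun (moddefect2 f).

Lemma moddefect_linear : linear moddefect.
Proof.
move=> c f g; apply/lfunP => a; apply/lfunP => v.
rewrite !(lfunE, lfun_simp) /= /moddefect2 !(lfun_simp, linearP) /=.
by rewrite scalerBr scalerN addrACA.
Qed.
HB.instance Definition _ :=
  GRing.isLinear.Build k 'Hom(V, W) 'Hom(A, 'Hom(V, W)) _ moddefect
    moddefect_linear.

Definition modhom : {vspace 'Hom(V, W)} := lker (linfun moddefect).

Lemma modhomP (f : 'Hom(V, W)) :
  reflect (forall a v, f (modact V a v) = modact W a (f v)) (f \in modhom).
Proof.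
rewrite memv_ker lfunE /=; apply: (iffP eqP) => [f0 a v | fA].
  have /lfunP/(_ v) := congr1 (fun h : 'Hom(A, 'Hom(V, W)) => h a) f0.
  by rewrite !lfunE /= !lfunE /= !lfunE /= => /eqP; rewrite subr_eq0 => /eqP.
apply/lfunP => a; apply/lfunP => v.
by rewrite !lfunE /= !lfunE /= !lfunE /= fA subrr.
Qed.

End ModHom.

Lemma modhom1 (V : fdmod A) : \1%VF \in modhom V V.
Proof. by apply/modhomP => a v; rewrite !id_lfunE. Qed.

Lemma modhomM (U V W : fdmod A) (g : subvs_of (modhom V W))
  (f : subvs_of (modhom U V)) : (vsval g \o vsval f)%VF \in modhom U W.
Proof.
apply/modhomP => a v; rewrite !comp_lfunE.
by rewrite (modhomP _ (subvsP f)) (modhomP _ (subvsP g)).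
Qed.

Definition mod_cat : category.
Proof.
apply: (@Category (fdmod A) (fun V W => subvs_of (modhom V W))
  (fun V => Subvs (modhom1 V)) (fun _ _ _ g f => Subvs (modhomM g f))).
- by move=> U V f; apply: subvs_inj; rewrite /= comp_lfun1l.
- by move=> U V f; apply: subvs_inj; rewrite /= comp_lfun1r.
- by move=> U V W X h g f; apply: subvs_inj; rewrite /= comp_lfunA.
Defined.

Definition mod_prelincat : prelincat k :=
  @PreLinCat k mod_cat
    (fun V W => Vector.class (subvs_of (modhom V W) : vectType k)).

Definition mod_lincat : lincat k.
Proof.
exists mod_prelincat => U V W.
- move=> g c f f'; apply: subvs_inj => /=.
  by rewrite comp_lfunDr comp_lfunZr.
- move=> f c g g'; apply: subvs_inj => /=.
  by rewrite comp_lfunDl comp_lfunZl.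
Defined.

End Modules.

Definition lin_equivalent (k : fieldType) (M M' : lincat k) : Prop :=
  exists (F : functor M M') (G : functor M' M),
    [/\ linear_functor F, linear_functor G,
        exists eta : nattrans (idfunctor M) (compfunctor G F), nat_iso eta
      & exists eps : nattrans (compfunctor F G) (idfunctor M'), nat_iso eps].

Definition finite_abelian (k : fieldType) (M : lincat k) : Prop :=
  exists A : fdalg k, lin_equivalent M (mod_lincat A).

(* A choice of objects V . x with isomorphisms
   Hom(V . x, y) ~ Hom_k(V, Hom(x, y)) natural in y. *)
Record copower (k : fieldType) (M : lincat k) := Copower {
  cop :> vectType k -> M -> M;
  cop_adj : forall (V : vectType k) (x y : M),
    'Hom(mor (cop V x) y, 'Hom(V, mor x y));
  cop_lift : forall (V : vectType k) (x y : M),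
    'Hom(V, mor x y) -> mor (cop V x) y;
  cop_adjK : forall (V : vectType k) (x y : M),
    cancel (@cop_adj V x y) (@cop_lift V x y);
  cop_liftK : forall (V : vectType k) (x y : M),
    cancel (@cop_lift V x y) (@cop_adj V x y);
  cop_adj_nat : forall (V : vectType k) (x y z : M)
    (h : mor y z) (g : mor (cop V x) y) (v : V),
    cop_adj V x z (h \oc g) v = h \oc cop_adj V x y g v }.

Section CopowerTheory.
Variables (k : fieldType) (M : lincat k) (T : copower M).

Definition cop_unit (V : vectType k) (x : M) : 'Hom(V, mor x (T V x)) :=
  cop_adj T V x (T V x) (idm (T V x)).

(* The image of v (x) f under V (x) Hom(p, x) ~ Hom(p, V . x). *)
Definition cop_tensor (V : vectType k) (p x : M) (v : V) (f : mor p x) :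
  mor p (T V x) := cop_unit V x v \oc f.

(* The bifunctoriality of V . x induced by the defining isomorphism. *)
Definition cop_map (V W : vectType k) (x y : M) (a : 'Hom(V, W))
  (f : mor x y) : mor (T V x) (T W y) :=
  cop_lift T (precomp (T W y) f \o (cop_unit W y \o a))%VF.

End CopowerTheory.

(* Dinatural families Hom(m, x)^* . x -> y, the integrand of the coend being
   (x', x) |-> Hom(m, x')^* . x. *)
Definition dinatural (k : fieldType) (M : lincat k) (T : copower M) (m y : M)
  (j : forall x : M, mor (T (vdual (mor m x)) x) y) : Prop :=
  forall (x x' : M) (f : mor x x'),
    j x' \oc cop_map T \1%VF f
    = j x \oc cop_map T (transpose (postcomp m f)) (idm x).

Record nakayama (k : fieldType) (M : lincat k) (T : copower M) := Nakayama {
  nak :> functor M M;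
  nak_i : forall x m : M, mor (T (vdual (mor m x)) x) (nak m);
  nak_dinatural : forall m : M, dinatural (fun x => nak_i x m);
  nak_universal : forall (m y : M)
    (j : forall x : M, mor (T (vdual (mor m x)) x) y), dinatural j ->
    exists! h : mor (nak m) y, forall x : M, h \oc nak_i x m = j x;
  nak_map : forall (m m' x : M) (f : mor m m'),
    fmap nak f \oc nak_i x m
    = nak_i x m' \oc cop_map T (transpose (precomp x f)) (idm x) }.

Definition Proj (k : fieldType) (M : lincat k) : category :=
  full_subcat (@projective M).

Section Traces.
Variables (k : fieldType) (M : lincat k) (S : functor M M).

Record trace := Trace {
  tr_fun :> forall p : Proj M, 'Hom(mor (sval p) (S (sval p)), k^o);
  trC : forall (p q : Proj M) (f : mor (sval p) (sval q))
    (g : mor (sval q) (S (sval p))), tr_fun p (g \oc f) = tr_fun q (fmap S f \oc g) }.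

Definition nondeg_trace (t : trace) : Prop :=
  forall (m : M) (p : Proj M),
    (forall f : mor m (S (sval p)),
       (forall g : mor (sval p) m, t p (f \oc g) = 0) -> f = 0) /\
    (forall g : mor (sval p) m,
       (forall f : mor m (S (sval p)), t p (f \oc g) = 0) -> g = 0).

Definition zero_trace : trace.
Proof. by exists (fun=> 0) => p q f g; rewrite !zero_lfunE. Defined.

Definition zero_nattrans (F : functor M M) : nattrans F S.
Proof. by exists (fun x => 0 : mor _ _) => x y f; rewrite comp0m compm0. Defined.

(* (m, p) |-> Hom(m, S p) *)
Definition h_sigma : functor (prod_cat (op_cat M) (Proj M)) (Vect k).
Proof.
exists (fun u : prod_cat (op_cat M) (Proj M) =>
          mor (u.1 : M) (S (sval u.2)) : vectType k)
  (fun u u' a => postcomp (u'.1 : M) (fmap S (a.2 : mor (sval u.2) (sval u'.2)))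
                 \o precomp (S (sval u.2)) (a.1 : mor (u'.1 : M) u.1))%VF.
- move=> [m p]; apply/lfunP => f /=.
  by rewrite comp_lfunE precompE postcompE fmap1 comp1m compm1 id_lfunE.
- move=> u v w b a; apply/lfunP => f /=.
  by rewrite !comp_lfunE !precompE !postcompE fmapM !compA.
Defined.

End Traces.

(* (m, p) |-> Hom(p, m)^* *)
Definition h_dual (k : fieldType) (M : lincat k) :
  functor (prod_cat (op_cat M) (Proj M)) (Vect k).
Proof.
exists (fun u : prod_cat (op_cat M) (Proj M) =>
          vdual (mor (sval u.2) (u.1 : M)))
  (fun u u' a => transpose (postcomp (sval u.2) (a.1 : mor (u'.1 : M) u.1)
     \o precomp (u'.1 : M) (a.2 : mor (sval u.2) (sval u'.2)))%VF).
- move=> [m p]; apply/lfunP => w; apply/lfunP => g /=.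
  rewrite transposeE id_lfunE !comp_lfunE precompE postcompE.
  by rewrite comp1m compm1.
- move=> u v w b a; apply/lfunP => x; apply/lfunP => g /=.
  rewrite comp_lfunE !transposeE !comp_lfunE !precompE !postcompE.
  by rewrite !compA.
Defined.

Section Phi2.
Variables (k : fieldType) (M : lincat k) (S : functor M M) (t : trace S).

Definition trace_pairing_fun (m : M) (p : Proj M)
  (f : mor m (S (sval p))) : 'Hom(mor (sval p) m, k^o) :=
  (t p \o postcomp (sval p) f)%VF.

Lemma trace_pairing_linear m p : linear (@trace_pairing_fun m p).
Proof.
move=> c f f'; apply/lfunP => g; rewrite /trace_pairing_fun.
rewrite !(lfun_simp) /= /post_fun -!(precompE g).
by rewrite !linearP.
Qed.
HB.instance Definition _ m p :=
  GRing.isLinear.Build k (mor m (S (sval p))) 'Hom(mor (sval p) m, k^o) _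
    (@trace_pairing_fun m p) (@trace_pairing_linear m p).

Definition trace_pairing m p :
  'Hom(mor m (S (sval p)), vdual (mor (sval p) m)) :=
  linfun (@trace_pairing_fun m p).

Lemma trace_pairingE m p (f : mor m (S (sval p))) (g : mor (sval p) m) :
  (trace_pairing m p f : 'Hom(_, k^o)) g = t p (f \oc g).
Proof. by rewrite lfunE /= comp_lfunE postcompE. Qed.

Definition Phi2 : nattrans (h_sigma S) (h_dual M).
Proof.
exists (fun u => trace_pairing u.1 u.2).
move=> [m p] [m' p'] [a b]; apply/lfunP => f; apply/lfunP => g /=.
rewrite comp_lfunE [RHS](congr1 (fun h : 'Hom(_, k^o) => h g) (comp_lfunE _ _ _)).
rewrite transposeE !comp_lfunE !trace_pairingE !precompE !postcompE.
by rewrite -!compA -trC !compA.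
Defined.

End Phi2.

(* set_bij over predicates: the universe of classical_sets.set is too small for
   families indexed by the objects of a category. *)
Definition bij_on (A B : Type) (P : A -> Prop) (Q : B -> Prop) (f : A -> B)
  : Prop :=
  [/\ forall x, P x -> Q (f x),
      forall x x', P x -> P x' -> f x = f x' -> x = x'
    & forall y, Q y -> exists2 x, P x & f x = y].

(* Definite description, with a default value when there is not exactly one
   element satisfying P. *)
Definition the (A : Type) (x0 : A) (P : A -> Prop) : A :=
  if pselect (exists! x, P x) is left ex then projT1 (cid ex) else x0.

Definition canonical_trace (k : fieldType) (M : lincat k) (T : copower M)
  (N : nakayama T) : trace N :=
  the (zero_trace N) (fun t =>
    forall (p : Proj M) (x : M) (w : 'Hom(mor (sval p) x, k^o))
      (f : mor (sval p) x),
      t p (nak_i N x (sval p)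
           \oc cop_tensor T (V := vdual (mor (sval p) x)) w f) = w f).

Section Phi.
Variables (k : fieldType) (M : lincat k) (T : copower M) (N : nakayama T).

Definition Phi1 (S : functor M M) (xi : nattrans S N) : trace S.
Proof.
exists (fun p => canonical_trace N p \o postcomp (sval p) (xi (sval p)))%VF.
move=> p q f g; rewrite !comp_lfunE !postcompE compA trC.
by rewrite !compA ncompE.
Defined.

(* Its inverse as a linear map, used in Phi3, is the total inverse of vector.v,
   which is a genuine inverse because this map is bijective. *)
Definition canonical_pairing (m : M) (p : Proj M) :
  'Hom(mor m (N (sval p)), vdual (mor (sval p) m)) :=
  @Phi2 k M N (canonical_trace N) (m, p).

Definition Phi3 (S : functor M M) (alpha : nattrans (h_sigma S) (h_dual M)) :
  nattrans S N :=
  the (zero_nattrans N S) (fun xi =>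
    forall (m : M) (p : Proj M),
      ((canonical_pairing m p)^-1
         \o (alpha (m, p) : 'Hom(mor m (S (sval p)), vdual (mor (sval p) m))))%VF
      = postcomp m (xi (sval p))).

End Phi.

Arguments Phi1 {k M T} N S xi.
Arguments Phi2 {k M} S t.
Arguments Phi3 {k M T} N S alpha.

(* Main.v *)
(* A finite abelian category has an object G such that Hom(G, -) is faithful and
   its dual Hom(G, -)^* is represented by an object D: for modules over A take
   G = A and D = A^*. Then G is a projective generator. Write [nak_elt w] for the
   morphism x -> N(m) which the coend attaches to w in Hom(m, x)^*. The component
   at G of the coend is an epimorphism, so every morphism p -> N(m) from a
   projective p is of the form [nak_elt w] with w in Hom(m, p)^*; w is unique
   because, through D, functionals on Hom(m, G) give morphisms out of the coend.
   Hence Hom(p, N(m)) = Hom(m, p)^*, and the canonical trace is evaluation at the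
   identity of p when m = p.

   A trace t and a transformation alpha determine each other through
   t(fg) = <alpha(f), g>, and non-degeneracy of the canonical trace turns alpha
   into a transformation Sigma -> N on projectives, which extends along projective
   presentations. Non-degenerate traces correspond to isomorphisms on projectives;
   as N is right exact, the inverse extends as well. *)
Require Import Defs.
From HB Require Import structures.
From mathcomp Require Import all_boot all_algebra.
From mathcomp Require Import boolp.
Set Implicit Arguments.
Unset Strict Implicit.
Unset Printing Implicit Defensive.
Import GRing.Theory Defs.
Local Open Scope ring_scope.
Local Open Scope cat_scope.

(** * Duality of finite-dimensional spaces *)

Section LinearAlgebra.
Variable k : fieldType.
Implicit Types U V W : vectType k.

Lemma lfun_inv_inj V W (f : 'Hom(V, W)) : injective f -> cancel f f^-1%VF.
Proof. by move=> /lker0P/lker0_lfunK. Qed.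

Lemma lfun_inv_surj V W (f : 'Hom(V, W)) :
  (forall w, exists v, f v = w) -> cancel f^-1%VF f.
Proof.
by move=> fS w; apply: limg_lfunVK; have [v <-] := fS w; rewrite memv_img ?memvf.
Qed.

Lemma linfun_linE V W (f : V -> W) : linear f -> linfun f =1 f.
Proof.
move=> fL v.
pose F := GRing.isLinear.Build k V W _ f fL.
exact: (lfunE (HB.pack f F)).
Qed.

Lemma dual_separates V (v : V) : (forall w : 'Hom(V, k^o), w v = 0) -> v = 0.
Proof.
move=> v0; rewrite (coord_vbasis (memvf v)) big1 // => i _.
have cL : linear (coord (vbasis fullv) i : V -> k^o).
  by move=> c u u'; rewrite linearP.
have := v0 (linfun (coord (vbasis fullv) i : V -> k^o)).
by rewrite linfun_linE // => ->; rewrite scale0r.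
Qed.

(** Since [f \o f^-1 \o f = f], any functional composed with [f \o f^-1 - \1] kills the image of
    [f], so it is zero by hypothesis; and functionals separate vectors. *)
Lemma dual_surj V W (f : 'Hom(V, W)) :
  (forall w : 'Hom(W, k^o), (w \o f)%VF = 0 -> w = 0) ->
  forall w, exists v, f v = w.
Proof.
move=> fd w; exists (f^-1%VF w); apply/eqP; rewrite -subr_eq0; apply/eqP.
apply: dual_separates => u.
have /fd u0 : ((u \o (f \o f^-1 - \1)) \o f = 0)%VF.
  by rewrite -comp_lfunA comp_lfunDl comp_lfunNl comp_lfun1l inv_lfun_def subrr
             comp_lfun0r.
have /lfunP/(_ w) := u0.
by rewrite comp_lfunE add_lfunE opp_lfunE comp_lfunE id_lfunE zero_lfunE.
Qed.

Lemma dim_dual V : \dim (fullv : {vspace 'Hom(V, k^o)}) = \dim (fullv : {vspace V}).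
Proof. by rewrite !dimvf /dim /= muln1. Qed.

Lemma inj_surj V W (f : 'Hom(V, W)) : injective f ->
  (\dim (fullv : {vspace W}) <= \dim (fullv : {vspace V}))%N ->
  forall w, exists v, f v = w.
Proof.
move=> fI le w; suff /memv_imgP[v _ ->] : w \in limg f by exists v.
suff -> : limg f = fullv by rewrite memvf.
apply/eqP; rewrite eqEdim subvf limg_dim_eq //.
by have /lker0P/eqP -> := fI; rewrite capv0.
Qed.

Lemma inj_dim V W (f : 'Hom(V, W)) : injective f ->
  (\dim (fullv : {vspace V}) <= \dim (fullv : {vspace W}))%N.
Proof.
move=> fI; rewrite -(@limg_dim_eq _ _ _ f fullv) ?dimvS ?subvf //.
by have /lker0P/eqP -> := fI; rewrite capv0.
Qed.

(** The condition on [w] embeds [W] into the dual of [V], so [vdual W] has dimension at most that of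
    [V] and the injective [f] is onto. *)
Lemma nondeg_pairing_surj V W (f : 'Hom(V, vdual W)) : injective f ->
  (forall w, (forall v, (f v : 'Hom(W, k^o)) w = 0) -> w = 0) ->
  forall u, exists v, f v = u.
Proof.
move=> fI fd; apply: inj_surj => //.
have fwL w : linear (fun v : V => (f v : 'Hom(W, k^o)) w).
  by move=> c u v; rewrite linearP add_lfunE scale_lfunE.
pose g w : 'Hom(V, k^o) := linfun (fun v : V => (f v : 'Hom(W, k^o)) w).
have gL : linear g.
  move=> c u v; apply/lfunP => x.
  by rewrite add_lfunE scale_lfunE /g !linfun_linE // linearP.
rewrite dim_dual -(dim_dual V); apply: (@inj_dim _ _ (linfun g)).
apply: raddf_inj => w /=; rewrite linfun_linE // => /lfunP w0.
by apply: fd => v; have := w0 v; rewrite linfun_linE // zero_lfunE.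
Qed.

(** The generalised inverse of [b] gives the witness: [b^-1 (b v) - v] lies in the kernel of [b],
    hence in the image of [a], where [w] vanishes. *)
Lemma dual_exact U V W (a : 'Hom(U, V)) (b : 'Hom(V, W)) :
  (forall v, b v = 0 -> exists u, a u = v) ->
  forall w : 'Hom(V, k^o), (w \o a)%VF = 0 ->
  exists w' : 'Hom(W, k^o), (w' \o b)%VF = w.
Proof.
move=> ex w wa0; exists (w \o b^-1)%VF; apply/lfunP => v.
rewrite !comp_lfunE; apply/eqP; rewrite -subr_eq0 -linearB; apply/eqP.
have [|u <-] := ex (b^-1%VF (b v) - v); last first.
  by rewrite /= -comp_lfunE wa0 zero_lfunE.
rewrite linearB /=; apply/eqP; rewrite subr_eq0; apply/eqP.
by rewrite -[RHS](congr1 (fun h : 'Hom(V, W) => h v) (inv_lfun_def b)) !comp_lfunE.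
Qed.

End LinearAlgebra.

Section Composition.
Variables (k : fieldType) (M : lincat k).

Lemma comp_sumr (I : Type) (r : seq I) (x y z : M) (g : mor y z)
  (f : I -> mor x y) : g \oc (\sum_(i <- r) f i) = \sum_(i <- r) g \oc f i.
Proof.
by rewrite -postcompE linear_sum; apply: eq_bigr => i _; rewrite /= postcompE.
Qed.

Lemma comp_suml (I : Type) (r : seq I) (x y z : M) (g : I -> mor y z)
  (f : mor x y) : (\sum_(i <- r) g i) \oc f = \sum_(i <- r) g i \oc f.
Proof.
by rewrite -precompE linear_sum; apply: eq_bigr => i _; rewrite /= precompE.
Qed.

Lemma comp_subl (x y z : M) (g h : mor y z) (f : mor x y) :
  (g - h) \oc f = g \oc f - h \oc f.
Proof. by rewrite -!precompE linearB. Qed.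

Lemma comp_subr (x y z : M) (h : mor y z) (f g : mor x y) :
  h \oc (f - g) = h \oc f - h \oc g.
Proof. by rewrite -!postcompE linearB. Qed.

Lemma linear_fmap0 (F : functor M M) (x y : M) :
  linear_functor F -> fmap F (0 : mor x y) = 0.
Proof. by move=> /(_ x y) FL; rewrite -(linfun_linE FL) linear0. Qed.

End Composition.

(** * Generators of module categories and of equivalent categories *)

Definition separator (C : category) (G : C) : Prop :=
  forall (x y : C) (f g : mor x y), (forall u : mor G x, f \oc u = g \oc u) -> f = g.

(** [e] is the universal functional: it corresponds to the identity of [D] under Hom(y, D) = Hom(G,
    y)^*. *)
Definition dual_represented (k : fieldType) (M : lincat k) (G D : M)
  (e : 'Hom(mor G D, k^o)) : Prop := forall y : M,
  (forall h : mor y D, (forall u : mor G y, e (h \oc u) = 0) -> h = 0) /\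
  (forall w : 'Hom(mor G y, k^o),
     exists h : mor y D, forall u : mor G y, e (h \oc u) = w u).

(** With Hom(G, x) read as the elements of [x], this says that a surjection is a cokernel of its
    kernel, without naming a kernel object. *)
Definition detects_factors (k : fieldType) (M : lincat k) (G : M) : Prop :=
  forall (x y t : M) (e : mor x y) (h : mor x t),
    (forall u : mor G y, exists v : mor G x, e \oc v = u) ->
    (forall v : mor G x, e \oc v = 0 -> h \oc v = 0) ->
    exists u : mor y t, u \oc e = h.

Definition has_generator (k : fieldType) (M : lincat k) : Prop :=
  exists (G D : M) (e : 'Hom(mor G D, k^o)),
    [/\ separator G, dual_represented e & detects_factors G].

(** * The regular module and its linear dual *)

Section RegularModule.
Variables (k : fieldType) (A : fdalg k).
Implicit Types V W : fdmod A.
Local Notation Amod := (mod_lincat A).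

Lemma regular_act1 (v : A) : alg_mul A (alg_one A) v = v.
Proof. exact: alg_mul1l. Qed.

Lemma regular_actM (a b v : A) :
  alg_mul A (alg_mul A a b) v = alg_mul A a (alg_mul A b v).
Proof. by rewrite alg_mulA. Qed.

Definition regular_mod : fdmod A := FDMod regular_act1 regular_actM.

Lemma modhom_linE V W (f : mor (V : Amod) W) (a : A) (v : V) :
  vsval f (modact V a v) = modact W a (vsval f v).
Proof. exact: (modhomP _ (subvsP f)). Qed.

Lemma modhom_ext V W (f g : mor (V : Amod) W) :
  (forall v, vsval f v = vsval g v) -> f = g.
Proof. by move=> fg; apply/subvs_inj/lfunP. Qed.

Lemma modhom_congr V W (f g : mor (V : Amod) W) (v : V) :
  f = g -> vsval f v = vsval g v.
Proof. by move=> ->. Qed.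

Lemma modhom0E V W (v : V) : vsval (0 : mor (V : Amod) W) v = 0.
Proof. exact: zero_lfunE. Qed.

Lemma modhomPE V W (c : k) (f g : mor (V : Amod) W) (v : V) :
  vsval (c *: f + g) v = c *: vsval f v + vsval g v.
Proof. by rewrite linearP add_lfunE scale_lfunE. Qed.

Lemma modhom_exists V W (f : V -> W) : linear f ->
  (forall a v, f (modact V a v) = modact W a (f v)) ->
  exists g : mor (V : Amod) W, forall v, vsval g v = f v.
Proof.
move=> fL fA.
have fh : linfun f \in modhom V W.
  by apply/modhomP => a v; rewrite !linfun_linE.
by exists (Subvs fh) => v; rewrite linfun_linE.
Qed.

Lemma regular_hom_exists V (v : V) :
  exists u : mor (regular_mod : Amod) V, forall a, vsval u a = modact V a v.
Proof.
apply: (@modhom_exists regular_mod V (fun a => modact V a v)) => [c a b|a b] /=.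
  by rewrite linearP add_lfunE scale_lfunE.
by rewrite modactM.
Qed.

Lemma regular_homE V (u : mor (regular_mod : Amod) V) (a : A) :
  vsval u a = modact V a (vsval u (alg_one A)).
Proof. by rewrite -modhom_linE /= alg_mul1r. Qed.

Definition rmul (b : A) : 'End(A) := linfun (fun a => alg_mul A a b).

Lemma rmulE b a : rmul b a = alg_mul A a b.
Proof.
by rewrite linfun_linE // => c x y; rewrite linearP add_lfunE scale_lfunE.
Qed.

(* The left action (a . w)(x) = w(x a) on A^*. *)
Definition codual_act_fun (a : A) : 'End(vdual A) := transpose (rmul a).

Lemma codual_act_linear : linear codual_act_fun.
Proof.
move=> c a b; apply/lfunP => w; apply/lfunP => x.
rewrite [in RHS]add_lfunE scale_lfunE /codual_act_fun !transposeE.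
by rewrite [RHS]add_lfunE scale_lfunE !comp_lfunE !rmulE !linearP.
Qed.

Lemma codual_actE a (w : 'Hom(A, k^o)) x :
  (linfun codual_act_fun a w : 'Hom(A, k^o)) x = w (alg_mul A x a).
Proof.
by rewrite (linfun_linE codual_act_linear) transposeE comp_lfunE rmulE.
Qed.

Lemma codual_act1 (w : vdual A) : linfun codual_act_fun (alg_one A) w = w.
Proof. by apply/lfunP => x; rewrite codual_actE alg_mul1r. Qed.

Lemma codual_actM a b (w : vdual A) :
  linfun codual_act_fun (alg_mul A a b) w
  = linfun codual_act_fun a (linfun codual_act_fun b w).
Proof. by apply/lfunP => x; rewrite !codual_actE alg_mulA. Qed.

Definition codual_mod : fdmod A := FDMod codual_act1 codual_actM.

Lemma codual_mod_actE a (w : 'Hom(A, k^o)) x :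
  (modact codual_mod a w : 'Hom(A, k^o)) x = w (alg_mul A x a).
Proof. exact: codual_actE. Qed.

Definition codual_form_fun (h : mor (regular_mod : Amod) codual_mod) : k^o :=
  (vsval h (alg_one A) : 'Hom(A, k^o)) (alg_one A).

Lemma codual_form_linear : linear codual_form_fun.
Proof.
move=> c h h'; rewrite /codual_form_fun linearP add_lfunE scale_lfunE.
by rewrite [LHS]add_lfunE scale_lfunE.
Qed.

Lemma codual_represents :
  @dual_represented k Amod regular_mod codual_mod (linfun codual_form_fun).
Proof.
move=> V; split=> [h h0|w].
  apply: modhom_ext => v; apply/lfunP => a.
  have [u uE] := regular_hom_exists (modact V a v).
  have := h0 u; rewrite (linfun_linE codual_form_linear) /codual_form_fun.
  rewrite comp_lfunE uE modact1 modhom_linE => h0a.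
  by rewrite modhom0E [RHS]zero_lfunE -[RHS]h0a codual_mod_actE alg_mul1l.
have /choice[u uE] := @regular_hom_exists V.
have uL : linear u.
  move=> c v v'; apply: modhom_ext => a.
  by rewrite modhomPE !uE linearP.
have wL v : linear (fun a => w (u (modact V a v))).
  by move=> c a b; rewrite linearP add_lfunE scale_lfunE uL linearP.
have [h hE] : exists h : mor (V : Amod) codual_mod, forall v,
    vsval h v = (linfun (fun a => w (u (modact V a v))) : 'Hom(A, k^o)).
  apply: modhom_exists => [c v v'|a v]; apply/lfunP => b.
    rewrite [RHS]add_lfunE scale_lfunE !linfun_linE // linearP uL.
    by rewrite linearP.
  by rewrite codual_mod_actE !linfun_linE // modactM.
exists h => f; rewrite (linfun_linE codual_form_linear) /codual_form_fun.
rewrite comp_lfunE hE linfun_linE // modact1; congr (w _).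
by apply: modhom_ext => a; rewrite uE -regular_homE.
Qed.

Lemma regular_separator : @separator Amod regular_mod.
Proof.
move=> V W f g fg; apply: modhom_ext => v.
have [u uE] := regular_hom_exists v.
have /(@modhom_congr regular_mod _ _ _ (alg_one A)) := fg u.
by rewrite !comp_lfunE !uE modact1.
Qed.

(** Morphisms out of A are elements, so [e] is onto and its kernel lies in that of [h]. Values of
    [h] thus depend only on those of [e], which makes [h \o e^-1] a module map. *)
Lemma regular_detects_factors : @detects_factors k Amod regular_mod.
Proof.
move=> V W X e h eS eh.
have eI : cancel (vsval e)^-1%VF (vsval e).
  apply: lfun_inv_surj => w; have [u uE] := regular_hom_exists w.
  have [v /(@modhom_congr regular_mod _ _ _ (alg_one A))] := eS u.
  by rewrite comp_lfunE uE modact1 => <-; exists (vsval v (alg_one A)).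
have h0 v : vsval e v = 0 -> vsval h v = 0.
  move=> ev0; have [u uE] := regular_hom_exists v.
  have /eh/(@modhom_congr regular_mod _ _ _ (alg_one A)) : e \oc u = 0.
    by apply: modhom_ext => a; rewrite comp_lfunE uE modhom_linE ev0 linear0 modhom0E.
  by rewrite comp_lfunE uE modact1 modhom0E.
have hE v v' : vsval e v = vsval e v' -> vsval h v = vsval h v'.
  by move=> /eqP; rewrite -subr_eq0 -linearB => /eqP/h0/eqP;
     rewrite linearB subr_eq0 => /eqP.
have [u uE] : exists u : mor (W : Amod) X, forall w,
    vsval u w = (vsval h \o (vsval e)^-1)%VF w.
  apply: modhom_exists => [c w w'|a w]; first by rewrite linearP.
  by rewrite !comp_lfunE -modhom_linE; apply: hE; rewrite modhom_linE !eI.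
exists u; apply: modhom_ext => v; rewrite comp_lfunE uE comp_lfunE.
by apply: hE; rewrite eI.
Qed.

Lemma mod_has_generator : has_generator Amod.
Proof.
exists regular_mod, codual_mod, (linfun codual_form_fun); split.
- exact: regular_separator.
- exact: codual_represents.
- exact: regular_detects_factors.
Qed.

End RegularModule.

(** * Transfer of a generator along a linear equivalence *)

Lemma iso_faithful (C D : category) (F : functor C D) (G : functor D C)
  (eta : nattrans (idfunctor C) (compfunctor G F)) : nat_iso eta ->
  forall x y (f g : mor x y), fmap F f = fmap F g -> f = g.
Proof.
move=> etaI x y f g Ffg; have [i [iK _]] := etaI y.
have /= ef := ncompE eta f; have /= eg := ncompE eta g.
have K (h : mor x y) : i \oc (eta y \oc h) = h by rewrite compA iK /= comp1m.
by rewrite -(K f) -(K g) ef eg Ffg.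
Qed.

Lemma coiso_faithful (C D : category) (F : functor C D) (G : functor D C)
  (eps : nattrans (compfunctor F G) (idfunctor D)) : nat_iso eps ->
  forall x y (f g : mor x y), fmap G f = fmap G g -> f = g.
Proof.
move=> epsI x y f g Gfg; have [i [_ Ki]] := epsI x.
have /= ef := ncompE eps f; have /= eg := ncompE eps g.
have K (h : mor x y) : h \oc eps x \oc i = h by rewrite -compA Ki /= compm1.
by rewrite -(K f) -(K g) -ef -eg Gfg.
Qed.

Lemma has_generator_equivalent (k : fieldType) (M M' : lincat k) :
  lin_equivalent M M' -> has_generator M' -> has_generator M.
Proof.
case=> F [G [FL GL [eta etaI] [eps epsI]]] [P [E [t [Psep tP Pfac]]]].
have Finj := iso_faithful etaI; have Ginj := coiso_faithful epsI.
have [ie ieP] : exists ie : forall x, mor (G (F x)) x,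
    forall x, ie x \oc eta x = idm x /\ eta x \oc ie x = idm (G (F x)).
  by exists (fun x => projT1 (cid (etaI x))) => x; case: cid.
(* Conjugation by the unit inverts [F] on morphisms. *)
pose Fi x y (v : mor (F x) (F y)) : mor x y := ie y \oc fmap G v \oc eta x.
have FiK x y (v : mor (F x) (F y)) : fmap F (Fi x y v) = v.
  apply: Ginj; have /= e := ncompE eta (Fi x y v).
  rewrite -[LHS]compm1 -(ieP x).2 compA -e /Fi !compA (ieP y).2 comp1m.
  by rewrite -!compA (ieP x).2 compm1.
have FiL x y : linear (Fi x y).
  move=> c u v; rewrite /Fi GL -(precompE _ (_ \oc _)) -(postcompE _ (_ + _)).
  by rewrite !linearP /= !precompE !postcompE.
have F0 x y : fmap F (0 : mor x y) = 0 by rewrite -(linfun_linE (FL x y)) linear0.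
have [iP [iPK PKi]] := epsI P; have [iE [iEK EKi]] := epsI E.
(* [up] and [dn] are the mutually inverse adjunction maps between Hom(G P, y) and Hom(P, F y); [t1]
   below is [t] read through them. *)
pose up y (u : mor (G P) y) : mor P (F y) := fmap F u \oc iP.
pose dn y (v : mor P (F y)) : mor (G P) y := Fi _ _ (v \oc eps P).
have upK y u : dn y (up y u) = u by apply: Finj; rewrite FiK -compA iPK compm1.
have dnK y v : up y (dn y v) = v by rewrite /up FiK -compA PKi compm1.
pose t1 (h : mor (G P) (G E)) : k^o := t (eps E \oc fmap F h \oc iP).
have t1L : linear t1.
  move=> c u v; rewrite /t1 FL -(precompE _ (_ \oc _)) -(postcompE _ (_ + _)).
  by rewrite !linearP /= !precompE !postcompE.
have t1E y (h : mor y (G E)) (u : mor (G P) y) :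
    linfun t1 (h \oc u) = t (eps E \oc fmap F h \oc up y u).
  by rewrite linfun_linE // /t1 fmapM !compA.
exists (G P), (G E), (linfun t1); split.
- move=> x y f g fg; apply/Finj/Psep => v.
  by rewrite -(dnK _ v) /up !compA -!fmapM fg.
- move=> y; have [ti ts] := tP (F y); split=> [h h0|w].
    have h0' : eps E \oc fmap F h = 0.
      by apply: ti => v; rewrite -(dnK _ v) -t1E h0.
    apply: Finj; rewrite F0 -(comp1m (fmap F h)) -[idm _]iEK -compA.
    by rewrite h0' compm0.
  have wL : linear (fun v : mor P (F y) => w (dn y v)).
    move=> c u v; rewrite /dn -precompE linearP /= FiL linearP.
    by rewrite !precompE.
  have [h hE] := ts (linfun (fun v : mor P (F y) => w (dn y v))).
  exists (Fi _ _ (iE \oc h)) => u; rewrite t1E FiK compA EKi comp1m hE.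
  by rewrite linfun_linE // upK.
- move=> x y z e h eS eh.
  have [v|v ev0|u uE] := @Pfac (F x) (F y) (F z) (fmap F e) (fmap F h).
  + by have [w wE] := eS (dn y v); exists (up x w); rewrite compA -fmapM wE; apply: dnK.
  + have /eh h0 : e \oc dn x v = 0.
      apply: Finj; rewrite F0 fmapM FiK compA ev0 comp0m //.
    by rewrite -(dnK _ v) /up compA -fmapM h0 F0 comp0m.
  + by exists (Fi _ _ u); apply: Finj; rewrite fmapM FiK.
Qed.

Lemma finite_abelian_has_generator (k : fieldType) (M : lincat k) :
  finite_abelian M -> has_generator M.
Proof.
by case=> A /has_generator_equivalent; apply; apply: mod_has_generator.
Qed.

(** * Traces and pairings *)

Lemma nattrans_ext (C D : category) (F G : functor C D) (a b : nattrans F G) :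
  (forall x, a x = b x) -> a = b.
Proof.
case: a b => [a aN] [b bN] /= ab.
have {}ab : a = b by apply: functional_extensionality_dep.
by subst b; congr NatTrans; apply: Prop_irrelevance.
Qed.

Lemma trace_ext (k : fieldType) (M : lincat k) (S : functor M M) (t t' : trace S) :
  (forall p f, t p f = t' p f) -> t = t'.
Proof.
case: t t' => [t tC] [t' tC'] /= tt'.
have {}tt' : t = t'.
  by apply: functional_extensionality_dep => p; apply/lfunP/tt'.
by subst t'; congr Trace; apply: Prop_irrelevance.
Qed.

Lemma the_spec (A : Type) (x0 : A) (P : A -> Prop) : (exists! x, P x) -> P (the x0 P).
Proof.
by rewrite /the; case: pselect => // ex _; case: cid => x [].
Qed.

Lemma bij_on_iff (A B : Type) (P : A -> Prop) (Q : B -> Prop) (f : A -> B) :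
  bijective f -> (forall x, P x <-> Q (f x)) -> bij_on P Q f.
Proof.
move=> [g fK gK] PQ; split=> [x /PQ //|x x' _ _ /(can_inj fK) //|y Qy].
by exists (g y) => //; apply/PQ; rewrite gK.
Qed.

Lemma Vect_is_iso (k : fieldType) (V W : Vect k) (f : mor V W) :
  is_iso f <-> (injective (f : 'Hom(V, W)) /\ forall w, exists v, (f : 'Hom(V, W)) v = w).
Proof.
split=> [[g [gf fg]]|[fI fS]].
  have gK : cancel (f : 'Hom(V, W)) (g : 'Hom(W, V)).
    by move=> v; rewrite -comp_lfunE [(_ \o _)%VF]gf id_lfunE.
  split; first exact: can_inj gK.
  by move=> w; exists ((g : 'Hom(W, V)) w); rewrite -comp_lfunE [(_ \o _)%VF]fg id_lfunE.
exists (f : 'Hom(V, W))^-1%VF; split; apply/lfunP => v; rewrite comp_lfunE id_lfunE.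
  exact: lfun_inv_inj.
exact: lfun_inv_surj.
Qed.

Section TracePairing.
Variables (k : fieldType) (M : lincat k) (S : functor M M).

Lemma pairing_injE (m : M) (p : Proj M) (t : trace S) :
  injective (trace_pairing t m p) <->
  forall f : mor m (S (sval p)), (forall g, t p (f \oc g) = 0) -> f = 0.
Proof.
split=> [tI f f0|t0].
  apply: tI; rewrite linear0; apply/lfunP => g.
  by rewrite trace_pairingE f0 zero_lfunE.
apply: raddf_inj => f /= /lfunP f0; apply: t0 => g.
by rewrite -trace_pairingE f0 zero_lfunE.
Qed.

(** Non-degeneracy in [f] is injectivity of the pairing map; together with non-degeneracy in [g] a
    dimension count gives surjectivity. Conversely, if all functionals are attained, a [g]
    orthogonal to everything is killed by every functional. *)
Lemma nondeg_trace_nat_iso (t : trace S) : nondeg_trace t <-> nat_iso (Phi2 S t).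
Proof.
split=> [tN [m p]|tI m p].
  apply/Vect_is_iso => /=; have [tl tr] := tN m p.
  have tI : injective (trace_pairing t m p) by apply/pairing_injE.
  split=> //; apply: nondeg_pairing_surj tI _ => g g0; apply: tr => f.
  by rewrite -trace_pairingE g0.
have /Vect_is_iso[/= /pairing_injE tl tS] := tI (m, p); split=> // g g0.
apply: dual_separates => w; have [f <-] := tS w.
by rewrite trace_pairingE g0.
Qed.

Definition nat_trace_fun (alpha : nattrans (h_sigma S) (h_dual M)) (p : Proj M)
  (f : mor (sval p) (S (sval p))) : k^o :=
  ((alpha (sval p, p) : 'Hom(_, 'Hom(mor (sval p) (sval p), k^o))) f) (idm (sval p)).

Lemma nat_trace_linear alpha p : linear (@nat_trace_fun alpha p).
Proof. by move=> c f g; rewrite /nat_trace_fun linearP add_lfunE scale_lfunE. Qed.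

Lemma nat_pairingE (alpha : nattrans (h_sigma S) (h_dual M)) (m m' : M) (p p' : Proj M)
  (f : mor m (S (sval p))) (b : mor m' m) (a : mor (sval p) (sval p'))
  (g : mor (sval p') m') :
  ((alpha (m', p') : 'Hom(_, 'Hom(mor (sval p') m', k^o))) (fmap S a \oc (f \oc b))) g
  = ((alpha (m, p) : 'Hom(_, 'Hom(mor (sval p) m, k^o))) f) (b \oc (g \oc a)).
Proof.
have := ncompE alpha ((b, a) : @mor (prod_cat (op_cat M) (Proj M)) (m, p) (m', p')).
move=> /(congr1 (fun h : 'Hom(mor m (S (sval p)), 'Hom(mor (sval p') m', k^o)) =>
  h f g)) /=.
by rewrite !comp_lfunE transposeE !comp_lfunE !precompE !postcompE.
Qed.

(** The trace is recovered by evaluating at the identity. Naturality in [m] and naturality in [p]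
    turn the two sides of the trace relation into the same value <alpha_{q,p}(g), f>. *)
Lemma nat_trace_exists (alpha : nattrans (h_sigma S) (h_dual M)) :
  exists t : trace S, Phi2 S t = alpha.
Proof.
pose t p : 'Hom(mor (sval p) (S (sval p)), k^o) := linfun (@nat_trace_fun alpha p).
have tE p f : t p f = nat_trace_fun alpha f.
  by rewrite (linfun_linE (@nat_trace_linear _ _)).
have tC (p q : Proj M) (f : mor (sval p) (sval q)) (g : mor (sval q) (S (sval p))) :
    t p (g \oc f) = t q (fmap S f \oc g).
  rewrite !tE /nat_trace_fun.
  have := nat_pairingE alpha g (idm (sval q)) f (idm (sval q)).
  have := nat_pairingE alpha g f (idm (sval p)) (idm (sval p)).
  by rewrite fmap1 !(comp1m, compm1) => -> ->.
exists (Trace tC); apply: nattrans_ext => -[m p]; apply/lfunP => f; apply/lfunP => g.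
rewrite /= trace_pairingE /= tE /nat_trace_fun.
have := nat_pairingE alpha f g (idm (sval p)) (idm (sval p)).
by rewrite fmap1 !(comp1m, compm1).
Qed.

Lemma Phi2_bijective : bijective (Phi2 S : trace S -> nattrans (h_sigma S) (h_dual M)).
Proof.
have /choice[g gK] := nat_trace_exists.
exists g => // t; apply: trace_ext => p f.
have E := congr1 (fun a : nattrans (h_sigma S) (h_dual M) =>
  (a (sval p, p) : 'Hom(_, 'Hom(mor (sval p) (sval p), k^o))) f (idm (sval p)))
  (gK (Phi2 S t)).
by move: E; rewrite /= !trace_pairingE compm1.
Qed.

End TracePairing.

(** * Projective objects and the Nakayama functor *)

Section Copowers.
Variables (k : fieldType) (M : lincat k) (T : copower M).
Implicit Types V W : vectType k.

Lemma cop_adjE V (x y : M) (g : mor (T V x) y) v :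
  cop_adj T V x y g v = g \oc cop_unit T V x v.
Proof. by rewrite -cop_adj_nat compm1. Qed.

Lemma cop_ext V (x y : M) (g h : mor (T V x) y) :
  (forall v, g \oc cop_unit T V x v = h \oc cop_unit T V x v) -> g = h.
Proof.
move=> gh; have gh' : cop_adj T V x y g = cop_adj T V x y h.
  by apply/lfunP => v; rewrite cop_adjE [RHS]cop_adjE.
by rewrite -(cop_adjK g) gh' cop_adjK.
Qed.

Lemma cop_lift_unit V (x y : M) (a : 'Hom(V, mor x y)) v :
  cop_lift T a \oc cop_unit T V x v = a v.
Proof. by rewrite -cop_adjE cop_liftK. Qed.

Lemma cop_map_unit V W (x y : M) (a : 'Hom(V, W)) (f : mor x y) v :
  cop_map T a f \oc cop_unit T V x v = cop_unit T W y (a v) \oc f.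
Proof. by rewrite cop_lift_unit !comp_lfunE precompE. Qed.

(** V . x is a direct sum of copies of [x] indexed by a basis of [V]: its identity is the sum of the
    inclusions composed with the coordinate projections, here composed with [h]. *)
Lemma cop_span V (p x : M) (h : mor p (T V x)) :
  exists n (v : 'I_n -> V) (f : 'I_n -> mor p x),
    h = \sum_(i < n) cop_unit T V x (v i) \oc f i.
Proof.
pose b := vbasis (fullv : {vspace V}).
have cL i : linear (fun v => coord b i v *: idm x).
  by move=> c u v; rewrite linearP scalerDl scalerA.
pose f i := cop_lift T (linfun (fun v => coord b i v *: idm x)).
exists (\dim (fullv : {vspace V})), (fun i => b`_i), (fun i => f i \oc h).
transitivity ((\sum_(i < \dim (fullv : {vspace V})) cop_unit T V x b`_i \oc f i)
  \oc h); last first.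
  by rewrite comp_suml; apply: eq_bigr => i _; rewrite compA.
rewrite -[LHS]comp1m; congr (_ \oc h); apply: cop_ext => v.
rewrite comp1m comp_suml [in LHS](coord_vbasis (memvf v)) linear_sum.
apply: eq_bigr => i _ /=; rewrite -compA cop_lift_unit linfun_linE //.
by rewrite -postcompE !linearZ /= postcompE compm1.
Qed.

(** Lifts along [e] are chosen linearly by the generalised inverse of Hom(p, e), so they assemble
    into a morphism out of V . p. *)
Lemma cop_projective V (p : M) :
  (forall (x y : M) (e : mor x y), is_epi e ->
     forall f : mor p y, exists g : mor p x, e \oc g = f) ->
  projective (T V p).
Proof.
move=> pP x y e f eE.
have eS : cancel (postcomp p e)^-1%VF (postcomp p e).
  by apply: lfun_inv_surj => u; have [g <-] := pP _ _ _ eE u;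
     exists g; rewrite postcompE.
exists (cop_lift T ((postcomp p e)^-1 \o cop_adj T V p y f)%VF).
apply: cop_ext => v; rewrite -compA cop_lift_unit comp_lfunE.
by rewrite -postcompE eS cop_adjE.
Qed.

End Copowers.

(** * Projective presentations built from the generator *)

Section Generator.
Variables (k : fieldType) (M : lincat k) (T : copower M).
Variables (G D : M) (e : 'Hom(mor G D, k^o)).
Hypotheses (Gsep : separator G) (eD : dual_represented e).
Hypothesis (Gfac : detects_factors G).

(* Hom(y, D) is dual to Hom(G, y), so a functional killing the image of
   Hom(G, f) comes from some h with h f = 0, hence h = 0. *)
Lemma generator_projective : projective G.
Proof.
move=> x y f u fE.
suff [g] : exists g, postcomp G f g = u by rewrite postcompE => ?; exists g.
apply: dual_surj => w wf0; have [h hE] := (eD y).2 w.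
suff h0 : h = 0 by apply/lfunP => v; rewrite -hE h0 comp0m linear0 zero_lfunE.
apply: fE; rewrite comp0m; apply: (eD x).1 => v.
by rewrite -compA hE -postcompE -comp_lfunE wf0 zero_lfunE.
Qed.

Definition evalG (x : M) : mor (T (mor G x) G) x := cop_lift T \1%VF.

Lemma evalG_unit x (u : mor G x) : evalG x \oc cop_unit T _ G u = u.
Proof. by rewrite cop_lift_unit id_lfunE. Qed.

Lemma evalG_epi x : is_epi (evalG x).
Proof.
by move=> y f g fg; apply: Gsep => u; rewrite -(evalG_unit u) !compA fg.
Qed.

Lemma copG_projective V : projective (T V G).
Proof. by apply: cop_projective => x y f fE g; apply: generator_projective. Qed.

(** The kernel [U] of Hom(G, evalG x) consists of the relations seen by [G], and U . G maps onto all
    of them; [Gfac] then makes [evalG x] a cokernel. *)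
Lemma projective_presentation (x : M) : exists (p q : M) (f : mor q p) (g : mor p x),
  [/\ projective p, projective q & is_cokernel f g].
Proof.
pose U := lker (postcomp G (evalG x)).
pose a : 'Hom(subvs_of U, mor G (T (mor G x) G)) := linfun vsval.
exists (T (mor G x) G), (T (subvs_of U) G), (cop_lift T a), (evalG x).
split; try exact: copG_projective.
split=> [|t h h0].
  apply: cop_ext => v; rewrite -compA cop_lift_unit comp0m lfunE /=.
  by have := subvsP v; rewrite memv_ker postcompE => /eqP.
have [u|v v0|u uE] := Gfac (e := evalG x) (h := h).
- by exists (cop_unit T _ G u); rewrite evalG_unit.
- have vU : v \in U by rewrite memv_ker postcompE v0.
  have <- : cop_lift T a \oc cop_unit T _ G (Subvs vU) = v.
    by rewrite cop_lift_unit lfunE.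
  by rewrite compA h0 comp0m.
- by exists u; split=> // u' u'E; apply: evalG_epi; rewrite uE u'E.
Qed.

(** A section of [evalG p] makes [p] a summand of a finite sum of copies of [G]; [cop_span] expands
    that section. *)
Lemma dual_basis (p : M) : projective p -> exists n (a : 'I_n -> mor p G)
  (b : 'I_n -> mor G p), idm p = \sum_i b i \oc a i.
Proof.
move=> pP; have [s sE] := pP _ _ _ (idm p) (@evalG_epi p).
have [n [v [f fE]]] := cop_span s; exists n, f, v.
rewrite -sE fE comp_sumr; apply: eq_bigr => i _.
by rewrite compA evalG_unit.
Qed.

Lemma cokernel_epi (x y z : M) (f : mor x y) (g : mor y z) :
  is_cokernel f g -> is_epi g.
Proof.
move=> [gf0 gU] t h h' hh'.
have [|u [_ uU]] := gU t (h \oc g); first by rewrite -compA gf0 compm0.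
by rewrite -(uU h) // -(uU h').
Qed.

(** * Morphisms into and out of the Nakayama coend *)

Section Nakayama.
Variable N : nakayama T.

Definition nak_elt (m x : M) (w : 'Hom(mor m x, k^o)) : mor x (N m) :=
  nak_i N x m \oc cop_unit T (vdual (mor m x)) x w.

Lemma nak_elt_linear m x : linear (@nak_elt m x).
Proof. by move=> c u v; rewrite /nak_elt linearP -postcompE linearP /= !postcompE. Qed.

Lemma nak_elt_dinatural (m x x' : M) (f : mor x x') (w : 'Hom(mor m x', k^o)) :
  nak_elt w \oc f = nak_elt (w \o postcomp m f)%VF.
Proof.
have := congr1 (fun h => h \oc cop_unit T (vdual (mor m x')) x w)
  (nak_dinatural N m f).
by rewrite -!compA !cop_map_unit transposeE id_lfunE compm1 !compA.
Qed.

Lemma nak_elt_map (m m' x : M) (f : mor m m') (w : 'Hom(mor m x, k^o)) :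
  fmap N f \oc nak_elt w = nak_elt (w \o precomp x f)%VF.
Proof.
by rewrite /nak_elt compA nak_map -compA cop_map_unit transposeE compm1.
Qed.

Lemma nak_elt_universal (m y : M) (j : forall x : M, 'Hom(mor m x, k^o) -> mor x y) :
  (forall x, linear (j x)) ->
  (forall x x' (f : mor x x') (w : 'Hom(mor m x', k^o)),
     j x' w \oc f = j x (w \o postcomp m f)%VF) ->
  exists h : mor (N m) y, forall x (w : 'Hom(mor m x, k^o)), h \oc nak_elt w = j x w.
Proof.
move=> jL jN.
pose j' x : mor (T (vdual (mor m x)) x) y := cop_lift T (linfun (j x)).
have [|h [hE _]] := @nak_universal _ _ _ N m y j'.
  move=> x x' f; apply: cop_ext => w.
  rewrite -!compA !cop_map_unit transposeE id_lfunE compm1 compA !cop_lift_unit.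
  by rewrite !(linfun_linE (jL _)) jN.
by exists h => x w; rewrite compA hE cop_lift_unit (linfun_linE (jL _)).
Qed.

Lemma nak_elt_ext (m y : M) (h h' : mor (N m) y) :
  (forall x (w : 'Hom(mor m x, k^o)), h \oc nak_elt w = h' \oc nak_elt w) -> h = h'.
Proof.
move=> hh'; have [x x' f|u [_ uU]] :=
    @nak_universal _ _ _ N m y (fun x => h \oc nak_i N x m).
  by rewrite -!compA nak_dinatural.
rewrite -(uU h) // -(uU h') // => x; apply: cop_ext => w.
by rewrite -!compA; apply/esym/hh'.
Qed.

Lemma nak_fmap0 (x y : M) : fmap N (0 : mor x y) = 0.
Proof.
apply: nak_elt_ext => z w; rewrite nak_elt_map comp0m.
rewrite (_ : (w \o _)%VF = 0) ?(linear0 (linfun _)).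
  by rewrite -(linfun_linE (@nak_elt_linear y z)) linear0.
by apply/lfunP => v; rewrite comp_lfunE precompE compm0 linear0 zero_lfunE.
Qed.

(** By dinaturality, [nak_elt w] composed with any G -> x factors through the component at [G], and
    [G] separates morphisms. *)
Lemma nak_i_epi (m : M) : is_epi (nak_i N G m).
Proof.
move=> y h h' hh'; apply: nak_elt_ext => x w; apply: Gsep => u.
by rewrite -[LHS]compA -[RHS]compA nak_elt_dinatural /nak_elt !compA hh'.
Qed.

Lemma nak_elt_surj (m p : M) : projective p ->
  forall h : mor p (N m), exists w : 'Hom(mor m p, k^o), nak_elt w = h.
Proof.
move=> pP h; have [s <-] := pP _ _ _ h (@nak_i_epi m).
have [n [v [f ->]]] := cop_span s.
exists (\sum_i ((v i : 'Hom(mor m G, k^o)) \o postcomp m (f i)))%VF.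
rewrite -(linfun_linE (@nak_elt_linear m p)) linear_sum comp_sumr.
apply: eq_bigr => i _ /=.
by rewrite (linfun_linE (@nak_elt_linear m p)) -nak_elt_dinatural compA.
Qed.

(** Fix g : m -> G. For [v] in Hom(m, x)^*, the functional u |-> v(u g) on Hom(G, x) is represented
    by a morphism x -> D. These form a dinatural family, hence give N(m) -> D, from which [e]
    recovers [w g]. *)
Lemma nak_elt_generator_inj (m : M) (w : 'Hom(mor m G, k^o)) :
  nak_elt w = 0 -> w = 0.
Proof.
move=> w0; apply/lfunP => g; rewrite zero_lfunE.
pose r y (v : 'Hom(mor G y, k^o)) : mor y D := projT1 (cid ((eD y).2 v)).
have rE y v u : e (r y v \oc u) = v u by rewrite /r; case: cid.
have rU y (h h' : mor y D) : (forall u, e (h \oc u) = e (h' \oc u)) -> h = h'.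
  move=> hh'; apply/eqP; rewrite -subr_eq0; apply/eqP; apply: (eD y).1 => u.
  by rewrite comp_subl linearB /= hh' subrr.
have [x|x x' f v|h hE] := @nak_elt_universal m D (fun x v => r x (v \o precomp x g)%VF).
- move=> c u v; apply: rU => f; rewrite rE -precompE !linearP /= !precompE !rE.
  by rewrite comp_lfunE add_lfunE scale_lfunE !comp_lfunE.
- apply: rU => u; rewrite -compA !rE !comp_lfunE !precompE postcompE.
  by rewrite compA.
have := rE _ (w \o precomp G g)%VF (idm G).
by rewrite compm1 -hE w0 compm0 linear0 comp_lfunE precompE comp1m.
Qed.

Lemma nak_elt_inj0 (m p : M) (w : 'Hom(mor m p, k^o)) :
  projective p -> nak_elt w = 0 -> w = 0.
Proof.
move=> pP w0; have [n [a [b abE]]] := dual_basis pP.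
apply/lfunP => g; rewrite zero_lfunE -(comp1m g) abE comp_suml linear_sum big1 //.
move=> i _ /=; have wb : (w \o postcomp m (b i))%VF = 0.
  by apply: nak_elt_generator_inj; rewrite -nak_elt_dinatural w0 comp0m.
by rewrite -compA -postcompE -comp_lfunE wb zero_lfunE.
Qed.

(** * Natural transformations determined on projectives, and right exactness of the Nakayama
    functor *)

Lemma nat_ext_projective (F H : functor M M) (a b : nattrans F H) : right_exact F ->
  (forall p, projective p -> a p = b p) -> a = b.
Proof.
move=> Fre ab; apply: nattrans_ext => x.
have [p [q [f [g [pP qP fg]]]]] := projective_presentation x.
by apply: (cokernel_epi (Fre _ _ _ _ _ fg)); rewrite !ncompE ab.
Qed.

Lemma nat_extension (F H : functor M M) (c : forall p, projective p -> mor (F p) (H p)) :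
  right_exact F -> (forall x y, fmap H (0 : mor x y) = 0) ->
  (forall p q (pP : projective p) (qP : projective q) (f : mor p q),
     c q qP \oc fmap F f = fmap H f \oc c p pP) ->
  exists a : nattrans F H, forall p (pP : projective p), a p = c p pP.
Proof.
move=> Fre H0 cN.
have ex x : exists u : mor (F x) (H x), forall p (pP : projective p) (g : mor p x),
    u \oc fmap F g = fmap H g \oc c p pP.
  have [p [q [f [g [pP qP fg]]]]] := projective_presentation x.
  have [|u [uE _]] := (Fre _ _ _ _ _ fg).2 _ (fmap H g \oc c p pP).
    by rewrite -compA (cN _ _ qP pP) compA -fmapM fg.1 H0 comp0m.
  (* Any morphism from a projective lifts through the presentation, so the induced [u] is compatible
     with all of them, not only with [g]; naturality of the extension rests on this. *)
  exists u => p' p'P g'; have [b <-] := p'P _ _ _ g' (cokernel_epi fg).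
  by rewrite !fmapM compA uE -!compA (cN _ _ p'P pP).
pose a x := projT1 (cid (ex x)).
have aE x p (pP : projective p) (g : mor p x) : a x \oc fmap F g = fmap H g \oc c p pP.
  by rewrite /a; case: cid.
have aN x y (f : mor x y) : a y \oc fmap F f = fmap H f \oc a x.
  have [p [q [f' [g [pP qP fg]]]]] := projective_presentation x.
  apply: (cokernel_epi (Fre _ _ _ _ _ fg)).
  by rewrite -!compA -fmapM !(aE _ _ pP) fmapM compA.
exists (NatTrans aN) => p pP /=.
by have := aE _ _ pP (idm p); rewrite !fmap1 compm1 comp1m.
Qed.

(* A morphism out of N(y) is a natural family of maps Hom(y, v)^* -> Hom(v, t), and
   Hom(x, v)^* -> Hom(y, v)^* -> Hom(z, v)^* -> 0 is exact. *)
Lemma nakayama_right_exact : right_exact N.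
Proof.
move=> x y z f g fg; have gE := cokernel_epi fg.
have preK v : cancel (precomp v g) (precomp v g)^-1%VF.
  by apply: lfun_inv_inj => u u'; rewrite !precompE => /gE.
have exw v (w : 'Hom(mor z v, k^o)) : exists w1 : 'Hom(mor y v, k^o),
    (w1 \o precomp v g)%VF = w.
  by exists (w \o (precomp v g)^-1)%VF; apply/lfunP => u; rewrite !comp_lfunE preK.
split=> [|t h h0]; first by rewrite -fmapM fg.1 nak_fmap0.
pose j v (w : 'Hom(mor z v, k^o)) := h \oc nak_elt (w \o (precomp v g)^-1)%VF.
(* Any other extension of a functional along Hom(g, v) serves equally: the difference vanishes on
   the image of Hom(g, v), which is the kernel of Hom(f, v), so it factors through Hom(f, v) and is
   killed because [h \oc fmap N f = 0]. *)
have jE v (w : 'Hom(mor y v, k^o)) : j v (w \o precomp v g)%VF = h \oc nak_elt w.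
  rewrite /j; apply/eqP; rewrite -subr_eq0 -comp_subr.
  rewrite -!(linfun_linE (@nak_elt_linear y v)) -linearB /=.
  rewrite (linfun_linE (@nak_elt_linear y v)).
  have [u||w' <-] := @dual_exact _ _ _ _ (precomp v g) (precomp v f) _
    (w \o precomp v g \o (precomp v g)^-1 - w)%VF.
  - rewrite precompE => /(fg.2 v)[r [rE _]]; exists r.
    by rewrite precompE.
  - apply: (proj1 (lfunP _ _)) => u.
    by rewrite comp_lfunE add_lfunE opp_lfunE !comp_lfunE preK subrr zero_lfunE.
  - by rewrite -nak_elt_map compA h0 comp0m.
have jL v : linear (j v).
  move=> c w w'; rewrite /j comp_lfunDl -comp_lfunZl nak_elt_linear.
  by rewrite -postcompE linearP /= !postcompE.
have [v v' f' w|u uE] := nak_elt_universal jL.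
  have [w1 <-] := exw _ w; rewrite jE -compA nak_elt_dinatural -jE; congr (j v _).
  apply/lfunP => s; rewrite !comp_lfunE !(precompE, postcompE).
  by rewrite compA.
exists u; split=> [|u' u'E].
  by apply: nak_elt_ext => v w; rewrite -compA nak_elt_map uE jE.
apply: nak_elt_ext => v w; have [w1 <-] := exw _ w.
by rewrite uE jE -u'E -nak_elt_map compA.
Qed.

(** * The canonical trace and its non-degeneracy *)

Lemma canonical_trace_exists : exists t : trace N, forall (p : Proj M) (x : M)
  (w : 'Hom(mor (sval p) x, k^o)) (f : mor (sval p) x), t p (nak_elt w \oc f) = w f.
Proof.
pose i (p : Proj M) : 'Hom('Hom(mor (sval p) (sval p), k^o), mor (sval p) (N (sval p))) :=
  linfun (@nak_elt (sval p) (sval p)).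
have iE p w : i p w = nak_elt w by rewrite (linfun_linE (@nak_elt_linear _ _)).
have iK p : cancel (i p) (i p)^-1%VF.
  apply: lfun_inv_inj; apply: raddf_inj => w /=; rewrite iE.
  exact: nak_elt_inj0 (proj2_sig p).
pose tf p (h : mor (sval p) (N (sval p))) : k^o := (i p)^-1%VF h (idm (sval p)).
have tfL p : linear (tf p).
  by move=> c h h'; rewrite /tf linearP add_lfunE scale_lfunE.
pose t p : 'Hom(mor (sval p) (N (sval p)), k^o) := linfun (tf p).
have tE (p : Proj M) (x : M) (w : 'Hom(mor (sval p) x, k^o)) (f : mor (sval p) x) :
    t p (nak_elt w \oc f) = w f.
  rewrite (linfun_linE (tfL p)) /tf nak_elt_dinatural -iE iK comp_lfunE postcompE.
  by rewrite compm1.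
(* Writing [g] as [nak_elt w] with [w] in Hom(p, q)^*, both sides equal [w f]. *)
have tC (p q : Proj M) (f : mor (sval p) (sval q)) (g : mor (sval q) (N (sval p))) :
    t p (g \oc f) = t q (fmap N f \oc g).
  have [w <-] := nak_elt_surj (proj2_sig q) g.
  rewrite tE nak_elt_map -[nak_elt _ in RHS]compm1 tE.
  by rewrite comp_lfunE precompE comp1m.
by exists (Trace tC).
Qed.

Lemma canonical_traceE (p : Proj M) (x : M) (w : 'Hom(mor (sval p) x, k^o))
  (f : mor (sval p) x) : canonical_trace N p (nak_elt w \oc f) = w f.
Proof.
have [t tE] := canonical_trace_exists.
rewrite -compA; apply: (@the_spec _ _ (fun t : trace N => forall (p : Proj M)
  (x : M) (w : 'Hom(mor (sval p) x, k^o)) (f : mor (sval p) x),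
  t p (nak_i N x (sval p) \oc cop_tensor T (V := vdual (mor (sval p) x)) w f) = w f)).
exists t; split=> [q y v g|t' t'E]; first by rewrite compA tE.
apply: trace_ext => q h; have [v <-] := nak_elt_surj (proj2_sig q) h.
by rewrite -[nak_elt v]compm1 tE -compA t'E.
Qed.

(** On the left, [f] is tested on u : G -> m: since [G] is projective, [f \oc u] is some
    [nak_elt w], and all values of [w] are traces. On the right, every functional on Hom(p, m) is
    the trace against some [nak_elt w]. *)
Lemma canonical_nondeg : nondeg_trace (canonical_trace N).
Proof.
move=> m p; split=> [f f0|g g0].
  apply: Gsep => u; rewrite comp0m.
  have [w wE] := nak_elt_surj generator_projective (f \oc u).
  suff w0 : w = 0 by rewrite -wE w0 -(linfun_linE (@nak_elt_linear _ _)) linear0.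
  by apply/lfunP => g; rewrite -canonical_traceE wE -compA f0 zero_lfunE.
by apply: dual_separates => w; rewrite -canonical_traceE g0.
Qed.

Lemma canonical_pairing_bij (m : M) (p : Proj M) :
  cancel (canonical_pairing N m p) (canonical_pairing N m p)^-1%VF /\
  cancel (canonical_pairing N m p)^-1%VF (canonical_pairing N m p).
Proof.
have /nondeg_trace_nat_iso/(_ (m, p))/Vect_is_iso[cI cS] := canonical_nondeg.
by split; [apply: lfun_inv_inj|apply: lfun_inv_surj].
Qed.

(** * Bijectivity of the maps and the non-degenerate case *)

Variable S : functor M M.
Hypotheses (Slin : linear_functor S) (Sre : right_exact S).

Definition Phi3_spec (alpha : nattrans (h_sigma S) (h_dual M)) (xi : nattrans S N) :=
  forall (m : M) (p : Proj M),
    ((canonical_pairing N m p)^-1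
       \o (alpha (m, p) : 'Hom(mor m (S (sval p)), vdual (mor (sval p) m))))%VF
    = postcomp m (xi (sval p)).

Lemma Phi3_spec_Phi1 (xi : nattrans S N) : Phi3_spec (Phi2 S (Phi1 N S xi)) xi.
Proof.
move=> m p; apply/lfunP => f; rewrite comp_lfunE postcompE.
apply: (can_inj (canonical_pairing_bij m p).1).
rewrite (canonical_pairing_bij m p).2; apply/lfunP => g.
by rewrite /= !trace_pairingE /= comp_lfunE postcompE compA.
Qed.

(** The Yoneda argument: take [m] to be S p and evaluate at its identity. *)
Lemma Phi3_spec_uniq alpha (xi xi' : nattrans S N) :
  Phi3_spec alpha xi -> Phi3_spec alpha xi' -> xi = xi'.
Proof.
move=> xiE xi'E; apply: nat_ext_projective => // p pP.
have := xiE (S p) (exist _ p pP); rewrite xi'E => /lfunP/(_ (idm _)).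
by rewrite !postcompE !compm1.
Qed.

Lemma Phi321 (xi : nattrans S N) : Phi3 N S (Phi2 S (Phi1 N S xi)) = xi.
Proof.
apply: (@Phi3_spec_uniq (Phi2 S (Phi1 N S xi))); last exact: Phi3_spec_Phi1.
apply: (@the_spec _ _ (Phi3_spec _)); exists xi; split; first exact: Phi3_spec_Phi1.
by move=> xi'; apply/Phi3_spec_uniq/Phi3_spec_Phi1.
Qed.

Lemma Phi1_surj (t : trace S) : exists xi : nattrans S N, Phi1 N S xi = t.
Proof.
pose i m p := (canonical_pairing N m p)^-1%VF.
have iK m p := (canonical_pairing_bij m p).1.
have Ki m p := (canonical_pairing_bij m p).2.
have tE m (p : Proj M) (f : mor m (S (sval p))) g :
    canonical_trace N p (i m p (trace_pairing t m p f) \oc g) = t p (f \oc g).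
  by rewrite -trace_pairingE Ki trace_pairingE.
have nd m (p : Proj M) (f f' : mor m (N (sval p))) :
    (forall g, canonical_trace N p (f \oc g) = canonical_trace N p (f' \oc g)) -> f = f'.
  move=> ff'; apply/eqP; rewrite -subr_eq0; apply/eqP.
  apply: (canonical_nondeg m p).1 => g.
  by rewrite comp_subl linearB /= ff' subrr.
(* The Yoneda element at [p], characterised by [cE]: the canonical trace of [c p pP \oc g] is the
   value of [t] at [g]. *)
pose c p (pP : projective p) : mor (S p) (N p) :=
  i (S p) (exist _ p pP) (trace_pairing t (S p) (exist _ p pP) (idm (S p))).
have cE p (pP : projective p) g :
    canonical_trace N (exist _ p pP) (c p pP \oc g) = t (exist _ p pP) g.
  by rewrite [LHS]tE comp1m.
have [p q pP qP f|xi xiE] := nat_extension (c := c) Sre nak_fmap0.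
  (* Naturality of [c] is tested against the canonical trace, where it becomes the trace relation
     for [t]. *)
  apply: (nd _ (exist _ q qP)) => g.
  rewrite -compA cE -compA.
  rewrite -[RHS](trC (canonical_trace N) (p := exist _ p pP) (q := exist _ q qP) f).
  by rewrite -compA cE [RHS]trC.
exists xi; apply: trace_ext => -[p pP] f /=.
by rewrite comp_lfunE postcompE xiE cE.
Qed.

Lemma Phi1_bijective : bijective (Phi1 N S : nattrans S N -> trace S).
Proof.
have /choice[g gK] := Phi1_surj.
exists g => // xi; have := Phi321 (g (Phi1 N S xi)).
by rewrite gK Phi321.
Qed.

Lemma Phi1_nondeg (xi : nattrans S N) : nat_iso xi <-> nondeg_trace (Phi1 N S xi).
Proof.
split=> [xiI m p|tN].
  have [z [zx xz]] := xiI (sval p).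
  split=> [f f0|g g0].
    rewrite -(comp1m f) -zx -compA.
    rewrite [X in z \oc X](_ : _ = 0) ?compm0 //.
    apply: (canonical_nondeg m p).1 => g.
    by rewrite -(f0 g) /= comp_lfunE postcompE compA.
  apply: (canonical_nondeg m p).2 => f.
  by rewrite -(g0 (z \oc f)) /= comp_lfunE postcompE !compA xz comp1m.
(* Both pairings being bijective, composition with [xi p] is bijective on Hom(m, S p) for every [m];
   the preimage of the identity of N p is the inverse. *)
have pI p : projective p -> is_iso (xi p).
  move=> pP; pose p' : Proj M := exist _ p pP.
  have pb m (q : Proj M) (f : mor m (S (sval q))) :
      canonical_pairing N m q (xi (sval q) \oc f) = trace_pairing (Phi1 N S xi) m q f.
    by apply/lfunP => g; rewrite /= !trace_pairingE /= comp_lfunE postcompE compA.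
  have /nondeg_trace_nat_iso tI := tN.
  have inj m (f f' : mor m (S p)) : xi p \oc f = xi p \oc f' -> f = f'.
    have /Vect_is_iso[fI _] := tI (m, p').
    by move=> ff'; apply: fI; rewrite /= -(pb _ p' f) -(pb _ p' f') /= ff'.
  have /Vect_is_iso[_ tS] := tI (N p, p').
  have [z zE] := tS (canonical_pairing N (N p) p' (idm (N p))).
  have xz : xi p \oc z = idm (N p).
    by apply: (can_inj (canonical_pairing_bij (N p) p').1); rewrite (pb _ p' z).
  by exists z; split=> //; apply: inj; rewrite compA xz comp1m compm1.
pose c p (pP : projective p) := projT1 (cid (pI p pP)).
have cE p (pP : projective p) :
    c p pP \oc xi p = idm (S p) /\ xi p \oc c p pP = idm (N p).
  by rewrite /c; case: cid.
have [x y|p q pP qP f|z zE] := nat_extension (c := c) nakayama_right_exact.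
- exact: linear_fmap0.
- rewrite -[LHS]compm1 -(cE _ pP).2 compA -[X in X \oc c p pP]compA -ncompE.
  by rewrite compA (cE _ qP).1 comp1m.
(* The two composites, taken as endotransformations of [S] and of [N], agree with the identities on
   projectives, hence everywhere by right exactness. *)
have zxN x y (f : mor x y) : z y \oc xi y \oc fmap S f = fmap S f \oc (z x \oc xi x).
  by rewrite -compA ncompE compA ncompE compA.
have xzN x y (f : mor x y) : xi y \oc z y \oc fmap N f = fmap N f \oc (xi x \oc z x).
  by rewrite -compA ncompE compA ncompE compA.
have id1 (F : functor M M) x y (f : mor x y) :
    idm (F y) \oc fmap F f = fmap F f \oc idm (F x).
  by rewrite comp1m compm1.
have zx : NatTrans zxN = NatTrans (id1 S).
  by apply: nat_ext_projective => // p pP /=; rewrite (zE _ pP) (cE _ pP).1.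
have xz : NatTrans xzN = NatTrans (id1 N).
  apply: nat_ext_projective; first exact: nakayama_right_exact.
  by move=> p pP /=; rewrite (zE _ pP) (cE _ pP).2.
move=> x; exists (z x); split.
  exact: (congr1 (fun a : nattrans S S => a x) zx).
exact: (congr1 (fun a : nattrans N N => a x) xz).
Qed.

End Nakayama.
End Generator.

Theorem theorem4p8 (k : fieldType) (M : lincat k) (hM : finite_abelian M)
  (T : copower M) (N : nakayama T)
  (S : functor M M) (hlin : linear_functor S) (hre : right_exact S) :
  [/\ bijective (Phi1 N S : nattrans S N -> trace S),
      bijective (Phi2 S : trace S -> nattrans (h_sigma S) (h_dual M)),
      bijective (Phi3 N S : nattrans (h_sigma S) (h_dual M) -> nattrans S N)
    & forall xi : nattrans S N, Phi3 N S (Phi2 S (Phi1 N S xi)) = xi] /\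
  [/\ bij_on (fun xi : nattrans S N => nat_iso xi)
        (fun t : trace S => nondeg_trace t) (Phi1 N S),
      bij_on (fun t : trace S => nondeg_trace t)
        (fun alpha : nattrans (h_sigma S) (h_dual M) => nat_iso alpha) (Phi2 S)
    & bij_on (fun alpha : nattrans (h_sigma S) (h_dual M) => nat_iso alpha)
        (fun xi : nattrans S N => nat_iso xi) (Phi3 N S)].
Proof.
have [G [D [e [Gsep eD Gfac]]]] := finite_abelian_has_generator hM.
have b1 := Phi1_bijective Gsep eD Gfac N hre.
have b2 := Phi2_bijective S.
have K := Phi321 Gsep eD Gfac (N := N) hre.
have n1 := Phi1_nondeg Gsep eD Gfac (N := N) hlin hre.
(* A left inverse of the bijection given by [Phi2] after [Phi1] is itself bijective. *)
have b3 : bijective (Phi3 N S) by apply: (bij_can_bij (bij_comp b2 b1)).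
split; split=> //; apply: bij_on_iff => //.
- exact: nondeg_trace_nat_iso.
(* Every [alpha] comes from some [xi], so the claim for [Phi3] follows from the two previous
   ones. *)
- move=> alpha; have [t <-] : exists t, Phi2 S t = alpha.
    by have [g _ gK] := b2; exists (g alpha).
  have [xi <-] : exists xi, Phi1 N S xi = t by have [g _ gK] := b1; exists (g t).
  by rewrite K; split=> [/nondeg_trace_nat_iso/n1|/n1/nondeg_trace_nat_iso].
Qed.
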